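(* Let $X$ be a Polish space, and let $\mathcal K(X)$ be the space of all compact subsets of $X$ with the Vietoris topology. Let $\mathcal I\subseteq\mathcal K(X)$ be a hereditary family that is comeager in $\mathcal K(X)$. Then there exists a set $\mathcal G\subseteq\mathcal I$ such that $\mathcal G$ is hereditary, $\mathcal G$ is a $G_\delta$ subset of $\mathcal K(X)$, and $\mathcal G$ is dense in $\mathcal K(X)$.
   Context: $\mathcal K(X)$ denotes the set of all compact subsets of $X$, including the empty set, equipped with the Vietoris topology, i.e. the topology generated by the sets $\{K\in\mathcal K(X):K\subseteq U\}$ and $\{K\in\mathcal K(X):K\cap U\neq\varnothing\}$ for $U\subseteq X$ open (so $\varnothing$ is an isolated point of $\mathcal K(X)$). A family $\mathcal A\subseteq\mathcal K(X)$ is hereditary if for all $K,L\in\mathcal K(X)$, $K\subseteq L$ and $L\in\mathcal A$ imply $K\in\mathcal A$. No definability assumption is made on $\mathcal I$, and the statement is a theorem of ZFC. *)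

(* Defs.v *)
From HB Require Import structures.
From mathcomp Require Import all_boot all_order all_algebra.
From mathcomp Require Import all_classical all_reals all_analysis.
From mathcomp Require Import borel_hierarchy.

Set Implicit Arguments.
Unset Strict Implicit.
Unset Printing Implicit Defensive.

Import Order.TTheory GRing.Theory Num.Theory.

Local Open Scope classical_set_scope.
Local Open Scope ring_scope.

Section Polish.
Context (R : realType) (X : topologicalType).

Record is_metric (d : X -> X -> R) : Prop := IsMetric {
  is_metric_refl : forall x, d x x = 0 ;
  is_metric_eq : forall x y, d x y = 0 -> x = y ;
  is_metric_sym : forall x y, d x y = d y x ;
  is_metric_triangle : forall x y z, d x z <= d x y + d y z }.

Definition induces_topology (d : X -> X -> R) : Prop :=
  forall x : X,
    nbhs x = filter_from [set e | 0 < e] (fun e => [set y | d x y < e]).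

Definition cauchy_seq (d : X -> X -> R) (u : nat -> X) : Prop :=
  forall e, 0 < e ->
    exists N, forall m n, (N <= m)%N -> (N <= n)%N -> d (u m) (u n) < e.

Definition complete_dist (d : X -> X -> R) : Prop :=
  forall u : nat -> X, cauchy_seq d u -> exists l : X, u @ \oo --> l.

Definition completely_metrizable : Prop :=
  exists d : X -> X -> R,
    [/\ is_metric d, induces_topology d & complete_dist d].

Definition separable : Prop := exists2 S : set X, countable S & dense S.

(* The real field R only serves as the codomain of the metric. X may be
   empty. *)
Definition polish : Prop := separable /\ completely_metrizable.

End Polish.

Section BaireCategory.
Context (T : topologicalType).

Definition nowhere_dense (A : set T) : Prop := interior (closure A) = set0.

Definition meager (A : set T) : Prop :=
  exists2 F : nat -> set T,
    (forall n, nowhere_dense (F n)) & A = \bigcup_n F n.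

Definition comeager (A : set T) : Prop := meager (~` A).

End BaireCategory.

Record compacts (X : topologicalType) : Type := Compacts {
  compacts_set :> set X ;
  compactsP : compact compacts_set }.

HB.instance Definition _ (X : topologicalType) := gen_eqMixin (compacts X).
HB.instance Definition _ (X : topologicalType) := gen_choiceMixin (compacts X).

Definition vietoris_subbase (X : topologicalType) : set_system (compacts X) :=
  [set [set K : compacts X | K `<=` U] | U in @open X] `|`
  [set [set K : compacts X | K `&` U !=set0] | U in @open X].

HB.instance Definition _ (X : topologicalType) :=
  isSubBaseTopological.Build (compacts X) (@vietoris_subbase X) id.

Definition hereditary (X : topologicalType) (A : set (compacts X)) : Prop :=
  forall K L : compacts X, K `<=` L -> A L -> A K.

(* Main.v *)
(** This transfers to [compacts X] the fact that a comeager hereditary family of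
    subsets of nat contains, for some partition of nat into intervals, every
    set that misses infinitely many of the intervals. A pair t = (Q, r) of a
    finite set and a radius codes the union of the balls B(q, r), q in Q, and
    the Vietoris open set of the compacts included in this union that meet
    each of these balls.

    Let U_n be decreasing dense open families with intersection inside I. The
    family sought is that of the compacts included in G_k for infinitely many
    k, where the open sets G_k are built together with finite lists T_k of
    codes: G_k is a union of small balls near the first k points of a dense
    sequence, shrunk so that every t in T_k has a refinement t' in T_(k+1)
    whose Vietoris open set is inside U_k and whose union of balls contains
    the part of G_k inside that of t. If K is included in G_k infinitely
    often, following these refinements along such k leads to a compact L
    containing K that belongs to every U_n, so that K is in I by heredity. *)

Require Import Defs.
From mathcomp Require Import all_boot all_order all_algebra.
From mathcomp Require Import all_classical all_reals all_analysis.
From mathcomp Require Import borel_hierarchy.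
From mathcomp Require Import lra.

Set Implicit Arguments.
Unset Strict Implicit.
Unset Printing Implicit Defensive.

Import Order.TTheory GRing.Theory Num.Theory.

Local Open Scope classical_set_scope.

(** * Filters and finite unions *)

Lemma filter_seq (T : eqType) (I : Type) (F : set_system I) (s : seq T)
    (P : T -> I -> Prop) : Filter F ->
  (forall x, x \in s -> \forall i \near F, P x i) ->
  \forall i \near F, forall x, x \in s -> P x i.
Proof.
move=> FF; elim: s => [|a s IHs] sP; first exact: nearW.
have Pa := sP a (mem_head _ _).
have {}IHs : \forall i \near F, forall x, x \in s -> P x i.
  by apply: IHs => x xs; apply: sP; rewrite in_cons xs orbT.
by apply: filterS2 Pa IHs => i Pai Psi x; rewrite in_cons => /predU1P[->|/Psi].
Qed.

Lemma ultra_seq (T : eqType) (I : Type) (F : set_system I) (s : seq T)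
    (P : T -> set I) : UltraFilter F ->
  F [set i | exists2 x, x \in s & P x i] -> exists2 x, x \in s & F (P x).
Proof.
move=> FU Fs; apply: contrapT => noP.
have Fn : \forall i \near F, forall x, x \in s -> ~ P x i.
  apply: filter_seq => x xs; case: (in_ultra_setVsetC (P x) FU) => // FP.
  by case: noP; exists x.
by case: (filter_ex (filterI Fs Fn)) => i [[x xs Pxi] /(_ _ xs)].
Qed.

(** * The Vietoris topology and finite sets *)

Section Vietoris.
Context (X : topologicalType).
Implicit Types (U : set X) (K L : compacts X) (O : set (compacts X)).

Lemma open_vietoris_subbase O : vietoris_subbase O -> open O.
Proof.
move=> sO; exists [set O]; last by rewrite bigcup_set1.
by move=> _ ->; exact: finI_from1.
Qed.

Lemma open_compacts_sub U : open U -> open [set K : compacts X | K `<=` U].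
Proof. by move=> oU; apply: open_vietoris_subbase; left; exists U. Qed.

Lemma open_compacts_meet U :
  open U -> open [set K : compacts X | K `&` U !=set0].
Proof. by move=> oU; apply: open_vietoris_subbase; right; exists U. Qed.

(** Open families are unions of finite intersections of subbasic ones, and a filter absorbs finite
    intersections; so only the two kinds of subbasic families need checking. *)
Lemma vietoris_open_filter (F : set_system (compacts X)) K : Filter F ->
  (forall U, open U -> K `<=` U -> F [set L : compacts X | L `<=` U]) ->
  (forall U, open U -> K `&` U !=set0 ->
     F [set L : compacts X | L `&` U !=set0]) ->
  forall O, open O -> O K -> F O.
Proof.
move=> FF Fsub Fmeet _ [D Dsub <-] [B DB BK].
apply: (@filterS _ _ _ B); first by move=> L BL; exists B.
have [E Esub EB] := Dsub _ DB; rewrite -EB in BK *.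
apply: filter_bigI => A EA; have AK : A K by exact: BK.
have [[U oU UA]|[U oU UA]] := set_mem (Esub _ EA); rewrite -UA in AK *.
  exact: Fsub.
exact: Fmeet.
Qed.

Definition seq_compacts (s : seq X) : compacts X :=
  Compacts (finite_compact (finite_seq s)).

(** A condition [K <= U] passes to all subsets of [K], and a meeting condition is witnessed by one
    point of [K]. The filter [F] collects finitely many such witnesses. *)
Lemma dense_seq_compacts O K : open O -> O K ->
  exists s, O (seq_compacts s).
Proof.
pose F := [set A : set (compacts X) | exists2 s : seq X,
  forall x, x \in s -> compacts_set K x &
  forall L, L `<=` K -> (forall x, x \in s -> compacts_set L x) -> A L].
have FF : Filter F.
  split; first by exists [::].
    move=> A B [s sK sA] [s' sK' sB]; exists (s ++ s').
      by move=> x; rewrite mem_cat => /orP[/sK|/sK'].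
    move=> L LK sL; split; [apply: sA|apply: sB] => // x xs; apply: sL;
      by rewrite mem_cat xs ?orbT.
  by move=> A B AB [s sK sA]; exists s => // L LK sL; apply/AB/sA.
move=> oO OK; have [||s sK sO] := @vietoris_open_filter F K FF _ _ O oO OK.
- by move=> U oU KU; exists [::] => // L LK _; exact: subset_trans KU.
- move=> U oU [x [Kx Ux]]; exists [:: x] => [y|L _ sL].
    by rewrite inE => /eqP ->.
  by exists x; split=> //; apply: sL; rewrite inE.
by exists s; apply: sO.
Qed.

End Vietoris.

(** * Codes by finite unions of balls and their refinements *)

Section Refinement.
Context (R : realType) (X : topologicalType) (d : X -> X -> R).
Context (d_metric : is_metric d) (d_top : induces_topology d).
Implicit Types (s t : seq X * R) (K L : compacts X) (e r : R).

Local Open Scope ring_scope.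

Let dxx := is_metric_refl d_metric.
Let dC := is_metric_sym d_metric.
Let d_triangle := is_metric_triangle d_metric.

Let d_ge0 x y : 0 <= d x y.
Proof.
by have := d_triangle x y x; rewrite dxx (dC y x) => ?; lra.
Qed.

Lemma near_add_lt (a b : R) : a < b -> \forall e \near 0^'+, a + e < b.
Proof.
move=> ab; near=> e; rewrite -ltrBrDl; near: e.
by apply: nbhs_right_lt; rewrite subr_gt0.
Unshelve. all: by end_near. Qed.

Lemma nbhs_ball_dist x e : 0 < e -> nbhs x [set y | d x y < e].
Proof. by move=> e0; rewrite d_top; exists e. Qed.

Lemma open_ball_dist x r : open [set y | d x y < r].
Proof.
rewrite openE => y /= xy; rewrite /interior d_top; exists (r - d x y) => /=.
  by rewrite subr_gt0.
by move=> z /= yz; have := d_triangle x y z; lra.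
Qed.

Lemma near_ball_dist x (U : set X) : open U -> U x ->
  \forall r \near 0^'+, [set y | d x y < r] `<=` U.
Proof.
move=> oU Ux; have := open_nbhs_nbhs (conj oU Ux); rewrite d_top.
move=> [e /= e0 eU]; near=> r => y /= xy; apply: eU => /=.
by apply: lt_trans xy _; near: r; exact: nbhs_right_lt.
Unshelve. all: by end_near. Qed.

Definition ballU t : set X := [set x | exists2 q, q \in t.1 & d q x < t.2].

Definition hball t : set (compacts X) :=
  [set K : compacts X | K `<=` ballU t /\
           forall q, q \in t.1 -> exists2 x, compacts_set K x & d q x < t.2].

(** The strict inequalities put the closed ball of radius [t'.2] around each new centre inside an
    open ball of [t]; this slack survives passage to limits. *)
Definition refines t' t : Prop :=
  [/\ 0 < t'.2,
      forall q', q' \in t'.1 -> exists2 q, q \in t.1 & d q q' + t'.2 < t.2 &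
      forall q, q \in t.1 -> exists2 q', q' \in t'.1 & d q q' + t'.2 < t.2].

Lemma refines_trans t2 t1 t3 : refines t1 t2 -> refines t2 t3 -> refines t1 t3.
Proof.
move=> [r1 t12 t21] [r2 t23 t32]; split=> // [q1 /t12[q2]|q3 /t32[q2]].
  move=> /t23[q3 q3t3 d32] d21; exists q3 => //.
  by have := d_triangle q3 q2 q1; lra.
move=> /t21[q1 q1t1 d21] d32; exists q1 => //.
by have := d_triangle q3 q2 q1; lra.
Qed.

Lemma sub_ballU t' t : refines t' t -> ballU t' `<=` ballU t.
Proof.
move=> [_ t't _] x [q' /t't[q qt qq'] q'x]; exists q => //.
by have := d_triangle q q' x; lra.
Qed.

Lemma open_ballU t : open (ballU t).
Proof.
rewrite (_ : ballU t = \bigcup_(q in [set` t.1]) [set x | d q x < t.2]).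
  by apply: bigcup_open => q _; exact: open_ball_dist.
by apply/seteqP; split=> x [q qt qx]; exists q.
Qed.

Lemma open_hball t : open (hball t).
Proof.
pose meets (s : seq X) := [set K : compacts X |
  forall q, q \in s -> exists2 x, compacts_set K x & d q x < t.2].
suff omeets (s : seq X) : open (meets s).
  exact: openI (open_compacts_sub (open_ballU t)) (omeets t.1).
elim: s => [|q s IHs].
  by rewrite (_ : meets [::] = setT); [exact: openT | apply/seteqP; split].
rewrite (_ : meets (q :: s) =
    [set K : compacts X | K `&` [set x | d q x < t.2] !=set0] `&` meets s).
  exact: openI (open_compacts_meet (open_ball_dist _ _)) IHs.
apply/seteqP; split=> [K sK|K [[x [Kx qx]] sK] q'].
  split; first by have [x Kx qx] := sK q (mem_head _ _); exists x.
  by move=> q' q's; apply: sK; rewrite in_cons q's orbT.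
by rewrite in_cons => /predU1P[->|/sK//]; exists x.
Qed.

Lemma hball_seq_compacts t : 0 < t.2 -> hball t (seq_compacts t.1).
Proof.
by move=> t0; split=> [q|q]; exists q => //; rewrite dxx.
Qed.

(** The families containing [hball (s, r)] for all small [r] form a filter; as [s] is finite, one
    radius serves all its points. *)
Lemma near_hball (O : set (compacts X)) (s : seq X) : open O ->
  O (seq_compacts s) -> \forall r \near 0^'+, hball (s, r) `<=` O.
Proof.
move=> oO Os.
pose F := [set A | \forall r \near 0^'+, hball (s, r) `<=` A].
have FF : Filter F.
  split; first exact: nearW.
    by move=> A B; rewrite /F /=; apply: filterS2 => r rA rB K rK; split;
      [exact: rA|exact: rB].
  move=> A B AB; rewrite /F /=; apply: filterS => r rA.
  exact: subset_trans AB.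
apply: (@vietoris_open_filter X F (seq_compacts s)) => // U oU.
  move=> sU; rewrite /F /=.
  have : \forall r \near 0^'+, forall q, q \in s -> [set x | d q x < r] `<=` U.
    by apply: filter_seq => q qs; apply: near_ball_dist => //; exact: sU.
  by apply: filterS => r rU K [Ks _] x /Ks[q qs qx]; exact: rU qx.
move=> [q [/= qs Uq]]; rewrite /F /=; apply: filterS (near_ball_dist oU Uq).
by move=> r rU K [_ /(_ q qs)[x Kx /rU Ux]]; exists x.
Qed.

Lemma near_refines t t' : 0 < t.2 ->
  {in t'.1, forall q', exists2 q, q \in t.1 & d q q' < t.2} ->
  {in t.1, forall q, exists2 q', q' \in t'.1 & d q q' < t.2} ->
  \forall r \near 0^'+, refines (t'.1, r) t.
Proof.
move=> t0 t't tt'; near=> r; split=> /=.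
- by near: r; exact: nbhs_right_gt.
- near: r; apply: filter_seq => q' /t't[q qt qq'].
  by apply: filterS (near_add_lt qq') => r; exists q.
- near: r; apply: filter_seq => q /tt'[q' qt qq'].
  by apply: filterS (near_add_lt qq') => r; exists q'.
Unshelve. all: by end_near. Qed.

Lemma refine_in_dense (U : set (compacts X)) t e : 0 < t.2 -> 0 < e ->
  open U -> dense U ->
  exists t', [/\ refines t' t, t'.2 <= e & hball t' `<=` U].
Proof.
move=> t0 e0 oU dU.
have [K [tK UK]] := dU _ (ex_intro _ _ (hball_seq_compacts t0)) (open_hball t).
have [s [[/= sub_s sub_t] Us]] :=
  dense_seq_compacts (openI (open_hball t) oU) (conj tK UK).
have [r [re rt rU]] : exists r,
    [/\ r <= e, refines (s, r) t & hball (s, r) `<=` U].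
  near (0 : R)^'+ => r; exists r; split; near: r.
  - exact: nbhs_right_le.
  (* Only the centres of [(s, e)] matter here; [e] is a placeholder. *)
  - by apply: (@near_refines t (s, e)).
  - exact: near_hball.
by exists (s, r).
Unshelve. all: by end_near. Qed.

(* Each ball of [s] that meets [t] is moved onto a point of [t'], hence its
   part inside [t] ends up inside [t']; the other balls do not see [t]. *)
Lemma refine_pair (U : set (compacts X)) s t e :
  0 < s.2 -> 0 < t.2 -> 0 < e -> open U -> dense U ->
  exists s' t', [/\ refines s' s, refines t' t, t'.2 <= e, hball t' `<=` U &
    ballU s' `&` ballU t `<=` ballU t'].
Proof.
move=> s0 t0 e0 oU dU.
(* [w p] is a point common to the ball at [p] and the union of [t], or [None] when they are
   disjoint. *)
have /choice[w wP] p : exists w : option X,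
    if w is Some a then d p a < s.2 /\ ballU t a
    else forall x, d p x < s.2 -> ~ ballU t x.
  have [[a [pa ta]]|na] := pselect (exists a, d p a < s.2 /\ ballU t a).
    by exists (Some a).
  by exists None => x px tx; apply: na; exists x.
(* With the witnesses added to the centres of [t], a refinement of [A] must have a centre close to
   each witness. *)
pose A := t.1 ++ pmap w s.1.
have [r [r0 rt rs]] : exists r, [/\ 0 < r, refines (A, r) t &
    forall p, p \in s.1 -> forall a, w p = Some a -> d p a + r < s.2].
  near (0 : R)^'+ => r; exists r; split.
  - by near: r; exact: nbhs_right_gt.
  - near: r; apply: (@near_refines t (A, e)) => //= q.
      rewrite mem_cat => /orP[qt|]; first by exists q; rewrite ?dxx.
      rewrite mem_pmap => /mapP[p ps /esym wp].
      by have := wP p; rewrite wp => -[_].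
    by move=> qt; exists q; rewrite ?dxx// mem_cat qt.
  - near: r; apply: filter_seq => p ps; have := wP p.
    case: (w p) => [a [pa _]|_]; last by apply: nearW.
    by apply: filterS (near_add_lt pa) => r par _ [<-].
have [t' [t'A t'e t'U]] := refine_in_dense (t := (A, r)) r0 e0 oU dU.
have [t'0 _ At'] := t'A.
(* [h p] is a centre of [t'] near the witness of [p]; without a witness, [p] stays in place. *)
have /choice[h hP] p : exists p', p \in s.1 ->
    if w p is Some a then p' \in t'.1 /\ d a p' + t'.2 < r else p' = p.
  case wp : (w p) => [a|]; last by exists p.
  have [ps|] := boolP (p \in s.1); last by exists p.
  have [|p' p't' ap'] := At' a; last by exists p'.
  by rewrite /= mem_cat mem_pmap -wp map_f ?orbT.
have sh p : p \in s.1 -> d p (h p) < s.2.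
  move=> ps; have := hP p ps; case wp : (w p) => [a|]; last first.
    by move=> ->; rewrite dxx.
  by move=> [_]; have := rs p ps a wp; have := d_triangle p a (h p); lra.
have [r' [r't' s's]] : exists r', r' <= t'.2 /\ refines (map h s.1, r') s.
  near (0 : R)^'+ => r'; exists r'; split; near: r'.
    exact: nbhs_right_le.
  apply: (@near_refines s (map h s.1, e)) => //= [q /mapP[p ps ->]|p ps].
    by exists p => //; exact: sh.
  by exists (h p); rewrite ?map_f//; exact: sh.
exists (map h s.1, r'), t'; split=> //; first exact: refines_trans rt.
move=> x [[_ /= /mapP[p ps ->] hpx] tx].
have := hP p ps; have := wP p; case: (w p) => [a [_ _] [hpt' _]|npt hp].
  by exists (h p) => //; exact: lt_le_trans r't'.
(* An unmoved ball has only shrunk, so it still misses [t]. *)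
case: (npt x) => //; rewrite -hp; apply: lt_le_trans hpx _.
by have [/= r'0 _ /(_ p ps)[q _]] := s's; have := d_ge0 p q; lra.
Unshelve. all: by end_near. Qed.

(** The codes of [T] are treated one by one, each time shrinking [s]; inclusions already obtained
    persist because [ballU] decreases under refinement. *)
Lemma refine_seq (U : set (compacts X)) s (T : seq (seq X * R)) e :
  0 < s.2 -> 0 < e -> open U -> dense U ->
  exists s' (T' : seq (seq X * R)), refines s' s /\
    forall t, t \in T -> 0 < t.2 -> exists t', [/\ t' \in T', refines t' t,
      t'.2 <= e, hball t' `<=` U & ballU s' `&` ballU t `<=` ballU t'].
Proof.
move=> s0 e0 oU dU; elim: T s s0 => [|t T IHT] s s0.
  have [t' [t's _ _]] := refine_in_dense s0 e0 oU dU.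
  by exists t', [::].
have [t0|t0] := boolP (0 < t.2); last first.
  have [s' [T' [s's TP]]] := IHT s s0; exists s', T'; split=> // u.
  by rewrite in_cons => /predU1P[-> /(negP t0)|/TP].
have [s1 [t1 [s1s t1t t1e t1U st1]]] := refine_pair s0 t0 e0 oU dU.
have [s1_gt0 _ _] := s1s.
have [s' [T' [s's1 TP]]] := IHT s1 s1_gt0.
exists s', (t1 :: T'); split; first exact: refines_trans s1s.
move=> u; rewrite in_cons => /predU1P[-> _|/TP + u0].
  exists t1; split=> //; first exact: mem_head.
  by apply: subset_trans st1; apply: setSI; exact: sub_ballU.
by move=> /(_ u0)[t' [t'T' *]]; exists t'; split=> //; rewrite in_cons t'T' orbT.
Qed.

End Refinement.

(** * Fusion of refining sequences of codes in a complete space *)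

Section Fusion.
Context (R : realType) (X : topologicalType) (d : X -> X -> R).
Context (d_metric : is_metric d) (d_top : induces_topology d).
Context (d_complete : complete_dist d).
Implicit Types (t : seq X * R) (K L : compacts X).

Local Open Scope ring_scope.

Let dC := is_metric_sym d_metric.
Let d_triangle := is_metric_triangle d_metric.

Definition vanishing (r : nat -> R) : Prop :=
  forall e, 0 < e -> exists N, forall n, (N <= n)%N -> r n < e.

Lemma vanishing_inv (r : nat -> R) :
  (forall n, r n.+1 <= n.+1%:R^-1) -> vanishing r.
Proof.
move=> rV e e0; have [k] := ltr_add_invr e0; rewrite add0r => ke.
(* Index 0 carries no bound, since a fusion starts from a code of arbitrary radius; hence the shift
   by one. *)
exists k.+1 => -[//|n kn]; apply: le_lt_trans (rV n) (le_lt_trans _ ke).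
by rewrite lef_pV2 ?posrE// ler_nat.
Qed.

Lemma vanishing_shift (r : nat -> R) n :
  vanishing r -> vanishing (fun k => r (n + k)%N).
Proof.
move=> r0 e /r0[N rN]; exists N => k Nk; apply: rN.
exact: leq_trans Nk (leq_addl _ _).
Qed.

(** Balls that meet pairwise satisfy the hypothesis, which makes their centres a Cauchy sequence. *)
Lemma balls_cvg (q : nat -> X) (r : nat -> R) : vanishing r ->
  (forall m n, d (q m) (q n) < r m + r n) ->
  exists l, forall e, 0 < e -> exists N, forall n, (N <= n)%N -> d l (q n) < e.
Proof.
move=> r0 qr; have [|l ql] := d_complete (u := q).
  move=> e e0; have [|N rN] := r0 (e / 2); first by lra.
  by exists N => m n /rN rm /rN rn; have := qr m n; lra.
exists l => e e0.
by have [N _ qN] := ql _ (nbhs_ball_dist d_top l e0); exists N => n /qN.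
Qed.

Lemma nested_balls (q : nat -> X) (r : nat -> R) :
  (forall n, 0 < r n) -> vanishing r ->
  (forall n, d (q n) (q n.+1) + r n.+1 < r n) ->
  exists l, forall n, d (q n) l < r n.
Proof.
move=> r_gt0 r0 qr.
have dqq x : d x x = 0 := is_metric_refl d_metric x.
have mono n k : d (q n) (q (n + k)%N) + r (n + k)%N <= r n.
  elim: k => [|k IHk]; first by rewrite addn0 dqq add0r.
  have := d_triangle (q n) (q (n + k)%N) (q (n + k.+1)%N).
  by have := qr (n + k)%N; rewrite addnS; lra.
have [m n|l ql] := @balls_cvg q r r0.
  wlog mn : m n / (m <= n)%N => [wlog_mn|].
    by case: (leqP m n) => [|/ltnW] /wlog_mn//; rewrite dC addrC.
  have := mono m (n - m)%N; rewrite subnKC//.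
  by have := r_gt0 n; lra.
(* The limit gives only a weak inequality; the slack of the next step makes it strict. *)
have le n : d (q n) l <= r n.
  apply/ler_addgt0Pr => e /ql[N qN]; have := qN _ (leq_addl n N).
  have := d_triangle (q n) (q (n + N)%N) l; have := mono n N.
  by have := r_gt0 (n + N)%N; rewrite (dC l); lra.
by exists l => n; have := d_triangle (q n) (q n.+1) l; have := le n.+1;
  have := qr n; lra.
Qed.

Section Sequence.
Variable t : nat -> seq X * R.
Hypotheses (t_gt0 : forall n, 0 < (t n).2) (t_vanishing : vanishing (snd \o t)).
Hypothesis t_refines : forall n, refines d (t n.+1) (t n).

Let L : set X := [set x | forall n, ballU d (t n) x].

Let compact_L : compact L.
Proof.
rewrite compact_ultra => F FU FL.
have Fmeet (A B : set X) : F A -> F B -> exists x, A x /\ B x.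
  by move=> FA FB; exact: filter_ex (filterI FA FB).
(* The ultrafilter selects one ball from each finite union. The selected balls meet pairwise, so
   their centres converge to some [l], the limit of [F]. *)
have /choice[q qP] n : exists q, q \in (t n).1 /\ F [set x | d q x < (t n).2].
  have /ultra_seq[q qt Fq] : F (ballU d (t n)) by apply: filterS FL => x; apply.
  by exists q.
have [m n|l ql] := @balls_cvg q _ t_vanishing.
  have [x [/= qm qn]] := Fmeet _ _ (qP m).2 (qP n).2.
  by have := d_triangle (q m) x (q n); rewrite (dC x); lra.
have Fl e : 0 < e -> F [set y | d l y < e].
  move=> e0; have e2 : 0 < e / 2 by lra.
  have [[N qN] [M rM]] := (ql _ e2, t_vanishing e2).
  apply: filterS (qP (maxn N M)).2 => x /= qx.
  have := qN _ (leq_maxl N M); have /= := rM _ (leq_maxr N M).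
  by have := d_triangle l (q (maxn N M)) x; lra.
exists l; split => [n|A]; last first.
  by rewrite d_top => -[e /= /Fl Fe eA]; exact: filterS eA Fe.
(* At level [n.+1] the limit is only known to lie in a closed ball, which sits inside an open ball
   of level [n]. *)
have [_ /(_ _ (qP n.+1).1)[p pt pq] _] := t_refines n; exists p => //.
suff : d (q n.+1) l <= (t n.+1).2 by have := d_triangle p (q n.+1) l; lra.
apply/ler_addgt0Pr => e /Fl Fe; have [x [/= lx qx]] := Fmeet _ _ Fe (qP n.+1).2.
by have := d_triangle (q n.+1) x l; rewrite (dC x); lra.
Qed.

(** The intersection of all the unions works: it meets each ball, because a chain of centres through
    the later codes gives nested balls shrinking to a point of it. *)
Lemma fusion : exists L, (forall n, hball d (t n) L) /\
  forall x, (forall n, ballU d (t n) x) -> compacts_set L x.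
Proof.
exists (Compacts compact_L); split=> // n; split=> [x Lx|q qt]; first exact: Lx.
have sub m k : ballU d (t (m + k)%N) `<=` ballU d (t m).
  elim: k => [|k IHk]; first by rewrite addn0.
  by rewrite addnS; apply: subset_trans IHk; exact: sub_ballU.
have /choice[h hP] : forall mx : nat * X, exists y, mx.2 \in (t mx.1).1 ->
    y \in (t mx.1.+1).1 /\ d mx.2 y + (t mx.1.+1).2 < (t mx.1).2.
  move=> [m x] /=; have [xt|] := boolP (x \in (t m).1); last by exists x.
  by have [_ _ /(_ x xt)[y]] := t_refines m; exists y.
pose u k := iteri k (fun i x => h ((n + i)%N, x)) q.
have ut k : u k \in (t (n + k)%N).1.
  elim: k => [|k /(hP (_, _))[+ _]]; first by rewrite addn0.
  by rewrite addnS.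
have [k||k|l ul] := @nested_balls u (fun k => (t (n + k)%N).2).
- exact: t_gt0.
- exact: (@vanishing_shift (snd \o t)).
- by have [_] := hP (_, _) (ut k); rewrite addnS.
exists l; last by have := ul 0%N; rewrite addn0.
(* Level [i] follows from the later level [n + i], where [u i] is a centre. *)
move=> i; apply: (sub i n); rewrite addnC.
by exists (u i).
Qed.

End Sequence.

(** A Rasiowa-Sikorski argument: [Q] lists the admissible codes and requirement [P n] is met at step
    [n]. The first conclusion serves density, the last one recovers a given compact inside [L]. *)
Lemma generic_fusion (Q : seq X * R -> Prop) (P : nat -> seq X * R -> Prop) t0 :
  (forall t, Q t -> 0 < t.2) -> Q t0 ->
  (forall n t, Q t -> exists t', [/\ Q t', refines d t' t,
     t'.2 <= n.+1%:R^-1 & P n t']) ->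
  exists L, [/\ hball d t0 L,
    forall n, exists2 t, P n t & hball d t L &
    forall x, (forall t, Q t -> ballU d t x) -> compacts_set L x].
Proof.
move=> Q_gt0 Q0 step.
have /choice[h hP] : forall nt : nat * (seq X * R), exists t', Q nt.2 ->
    [/\ Q t', refines d t' nt.2, t'.2 <= nt.1.+1%:R^-1 & P nt.1 t'].
  move=> [n t] /=; have [/(step n)[t' ?]|nQ] := pselect (Q t).
    by exists t'.
  by exists t.
pose t k := iteri k (fun i t => h (i, t)) t0.
have Qt n : Q (t n) by elim: n => // n /(hP (n, _))[].
have tP n := hP (n, _) (Qt n).
have [n||n|L [tL LP]] := @fusion t.
- exact: Q_gt0.
- by apply: vanishing_inv => n; have [] := tP n.
- by have [] := tP n.
exists L; split=> [|n|x Qx]; first exact: (tL 0%N).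
  by exists (t n.+1) => //; have [] := tP n.
by apply: LP => n; exact: Qx.
Qed.

End Fusion.

(** * Countable sets and Baire category *)

Lemma countable_enum (T : Type) (S : set T) : countable S ->
  exists g : nat -> option T, forall x, S x -> exists n, g n = Some x.
Proof.
move=> /pcard_leP[f].
have /choice[g gP] n : exists o : option T, forall x, S x -> f x = n -> o = Some x.
  have [[x [Sx <-]]|nx] := pselect (exists x, S x /\ f x = n).
    by exists (Some x) => y Sy /(@inj _ _ _ f); rewrite !inE => -> //.
  by exists None => x Sx fx; case: nx; exists x.
by exists g => x Sx; exists (f x); exact: gP.
Qed.

Lemma dense_setC_closure (T : topologicalType) (A : set T) :
  nowhere_dense A -> dense (~` closure A).
Proof.
move=> A0 O [x Ox] oO; apply: contrapT => OA.
have : (interior (closure A)) x; last by rewrite A0.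
rewrite /interior; apply: filterS (open_nbhs_nbhs (conj oO Ox)) => y Oy.
by apply: contrapT => Ay; apply: OA; exists y.
Qed.

Lemma comeager_sub (T : topologicalType) (A : set T) : comeager A ->
  exists U : nat -> set T, [/\ forall n, open (U n), forall n, dense (U n),
    forall m n, (m <= n)%N -> U n `<=` U m & \bigcap_n U n `<=` A].
Proof.
move=> [F F0 FA].
(* Finite intersections make the dense open sets decreasing. *)
pose U n := [set x | forall i, (i <= n)%N -> ~ closure (F i) x].
have U0 : U 0%N = ~` closure (F 0%N).
  by apply/seteqP; split=> [x /(_ 0%N)|x Fx [|//]]; [exact|].
have US n : U n.+1 = ~` closure (F n.+1) `&` U n.
  apply/seteqP; split=> [x Ux|x [Fx Ux] i].
    by split=> [|i in_]; apply: Ux => //; exact: leqW.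
  by rewrite leq_eqVlt => /predU1P[->//|]; exact: Ux.
have oF n : open (~` closure (F n)) by exact/closed_openC/closed_closure.
exists U; split.
- by elim=> [|n IHn]; rewrite ?U0 ?US//; exact: openI.
- elim=> [|n IHn]; rewrite ?U0 ?US; first exact: dense_setC_closure.
  by apply: denseI => //; exact: dense_setC_closure.
- by move=> m n mn x Ux i im; apply: Ux; exact: leq_trans mn.
move=> x Ux; apply: contrapT => nAx.
have : (~` A) x by []; rewrite FA => -[n _ Fx].
exact: (Ux n I n (leqnn n) (subset_closure Fx)).
Qed.

(** * Compacts contained in infinitely many of the given open sets *)

Section HereditaryGdelta.
Context (X : topologicalType) (G : nat -> set X).
Hypothesis G_open : forall n, open (G n).

Definition often_inside : set (compacts X) :=
  [set K : compacts X | forall n, exists2 k, (n <= k)%N & K `<=` G k].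

Lemma hereditary_often_inside : hereditary often_inside.
Proof.
move=> K L KL Lo n; have [k nk LG] := Lo n; exists k => //.
exact: subset_trans LG.
Qed.

Lemma Gdelta_often_inside : Gdelta often_inside.
Proof.
exists (fun n => \bigcup_(k in [set k | (n <= k)%N])
    [set K : compacts X | K `<=` G k]).
  by move=> n; apply: bigcup_open => k _; exact: open_compacts_sub.
by apply/seteqP; split=> [K Ko n _|K Ko n]; [exact: Ko|exact: (Ko n)].
Qed.

End HereditaryGdelta.

(** * Construction of the hereditary dense G-delta family *)

Theorem theorem1p1 (R : realType) (X : topologicalType) (hX : polish R X)
  (I : set (compacts X)) (hI : hereditary I) (cI : comeager I) :
  exists G : set (compacts X),
    [/\ G `<=` I, hereditary G, Gdelta G & dense G].
Proof.
have [[S /countable_enum[g gS] dS] [d [d_metric d_top d_complete]]] := hX.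
have [U [oU dU U_anti UI]] := comeager_sub cI.
pose s k : seq X * R := (pmap g (iota 0 k.+1), (k.+1%:R^-1)%R).
have V_gt0 n : (0 < n.+1%:R^-1 :> R)%R by rewrite invr_gt0.
have /choice[F FP] : forall kT : nat * seq (seq X * R),
    exists sT : (seq X * R) * seq (seq X * R), refines d sT.1 (s kT.1) /\
    forall t, t \in kT.2 -> (0 < t.2)%R ->
      exists t', [/\ t' \in sT.2, refines d t' t, (t'.2 <= kT.1.+1%:R^-1)%R,
        hball d t' `<=` U kT.1 & ballU d sT.1 `&` ballU d t `<=` ballU d t'].
  move=> [k T].
  have [s' [T' sT]] := refine_seq d_metric d_top T (V_gt0 k : (0 < (s k).2)%R)
    (V_gt0 k) (oU k) (@dU k).
  by exists (s', T').
(* The lists grow, and the code of [G i] itself joins the list: it will be the starting code of the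
   fusion for a compact inside [G i]. *)
pose T k := iteri k (fun i T => T ++ (F (i, T)).1 :: (F (i, T)).2) [::].
pose s' k := (F (k, T k)).1.
pose G k := ballU d (s' k).
have s's k : refines d (s' k) (s k) := (FP (k, T k)).1.
have s'T k : s' k \in T k.+1 by rewrite /= mem_cat mem_head orbT.
have T_mono m n t : (m <= n)%N -> t \in T m -> t \in T n.
  move=> mn tm; rewrite -(subnKC mn); elim: (n - m)%N => [|k IHk].
    by rewrite addn0.
  by rewrite addnS /= mem_cat IHk.
exists (often_inside G); split.
- move=> K Ko.
  pose Q t := [/\ (0 < t.2)%R, K `<=` ballU d t & exists k, t \in T k].
  have [k0 _ KG0] := Ko 0%N.
  have [s'0 _ _] := s's k0.
  have [t|||L [_ LU KL]] := generic_fusion d_metric d_top d_complete (Q := Q)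
      (P := fun n t => hball d t `<=` U n) (t0 := s' k0).
  + by case.
  + by split=> //; exists k0.+1.
  + move=> n t [t0 Kt [m tm]].
    (* Past [m], stage [k] treats [t]; past [n], its radius and its dense family are good enough for
       requirement [n]. *)
    have [k mnk KG] := Ko (maxn m n); rewrite geq_max in mnk.
    have /andP[mk nk] := mnk.
    have [_ /(_ t (T_mono _ _ _ mk tm) t0)[t' /=]] := FP (k, T k).
    move=> [t'T t't t'k t'U Gt]; exists t'; split=> //.
    * split; first by have [] := t't.
        by move=> x Kx; apply: Gt; split; [exact: KG|exact: Kt].
      by exists k.+1; rewrite /= mem_cat in_cons t'T !orbT.
    * by apply: le_trans t'k _; rewrite lef_pV2 ?posrE// ler_nat.
    * by apply: subset_trans t'U _; exact: U_anti.
  have IL : I L by apply: UI => n _; have [t tU /tU] := LU n.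
  by apply: hI IL => x Kx; apply: KL => t [_ + _]; exact.
- exact: hereditary_often_inside.
- by apply: Gdelta_often_inside => k; exact: open_ballU.
move=> O [K OK] oO.
have [q Oq] := dense_seq_compacts oO OK.
have [r [r0 rO]] : exists r, (0 < r)%R /\ hball d (q, r) `<=` O.
  near (0 : R)^'+%R => r; exists r; split; near: r.
    exact: nbhs_right_gt.
  exact: near_hball.
(* Density: requirement [n] asks for a code inside some [G k] with [k >= n], so the fused compact
   lies in infinitely many [G k]. *)
have [t|||L [qL LG _]] := generic_fusion d_metric d_top d_complete
    (Q := fun t => (0 < t.2)%R) (t0 := (q, r))
    (P := fun n t => exists2 k, (n <= k)%N & ballU d t `<=` G k).
- by [].
- by [].
- move=> n t t0; have t2 : (0 < t.2 / 2)%R by lra.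
  (* Half of the radius of [t] is spent on reaching a centre of [s k], the other half on its
     displacement in [s' k]. *)
  have [k [nk kt sk]] : exists k, [/\ (n <= k)%N, (k.+1%:R^-1 < t.2 / 2)%R &
      forall q, q \in t.1 -> exists2 x, x \in (s k).1 & (d q x < t.2 / 2)%R].
    near \oo => k; exists k; split; near: k.
    + exact: nbhs_infty_ge.
    + exact: (near_infty_natSinv_lt (PosNum t2)).
    + apply: filter_seq => p _.
      have pball : [set y | (d p y < t.2 / 2)%R] !=set0.
        by exists p; rewrite /= (is_metric_refl d_metric); lra.
      have [x [/= px Sx]] := dS _ pball
        (open_ball_dist d_metric d_top p (t.2 / 2)%R).
      have [m gm] := gS x Sx; exists m => // k /= mk; exists x => //.
      suff : x \in pmap g (iota 0 k.+1) by [].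
      by rewrite mem_pmap -gm map_f // mem_iota.
  have /choice[h hP] p : exists p', p \in t.1 -> (d p p' < t.2)%R /\ G k p'.
    have [/sk[x xk px]|] := boolP (p \in t.1); last by exists p.
    have [s'k_gt0 _ /(_ x xk)[p' p's' xp']] := s's k; exists p'; split.
      have xp : (d x p' < t.2 / 2)%R.
        by apply: lt_trans kt; apply: lt_trans xp'; rewrite ltrDl.
      by have := is_metric_triangle d_metric p x p'; lra.
    by exists p' => //; rewrite (is_metric_refl d_metric).
  (* The new centres lie in the open set [G k], so small balls around them stay inside it. *)
  have [r' [r'n r't r'G]] : exists r', [/\ (r' <= n.+1%:R^-1)%R,
      refines d (map h t.1, r') t & ballU d (map h t.1, r') `<=` G k].
    near (0 : R)^'+%R => r'; exists r'; split; near: r'.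
    + exact: nbhs_right_le.
    + apply: (@near_refines _ _ d t (map h t.1, t.2)) => //= [_ /mapP[p pt ->]|p pt].
        by exists p => //; case: (hP p pt).
      by exists (h p); rewrite ?map_f//; case: (hP p pt).
    + have : \forall e \near (0 : R)^'+%R, forall p, p \in t.1 ->
          [set y | (d (h p) y < e)%R] `<=` G k.
        apply: filter_seq => p /hP[_ Gp].
        by apply: near_ball_dist => //; exact: open_ballU.
      by apply: filterS => e eG x [_ /mapP[p pt ->]]; exact: eG.
  exists (map h t.1, r'); split=> //; last by exists k.
  by have [] := r't.
exists L; split; first exact: rO.
move=> n; have [t [k nk tG] [Lt _]] := LG n.
by exists k => //; exact: subset_trans tG.
Unshelve. all: by end_near. Qed.
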